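(* Let $m\ge1$ and $\kappa_m=\sqrt{\ln(4m)/\pi}$. The average number of edges of the minimal dag of an $m$-labeled binary tree of size $n$, taken uniformly at random, satisfies $$\bar E^{\mathcal B}_{m,n}=3\kappa_m\frac{n}{\sqrt{\ln n}}\left(1+O\!\left(\frac1{\ln n}\right)\right)\quad(n\to\infty).$$
   Context: An $m$-labeled binary tree is a non-empty finite rooted tree with node labels in $\{1,\dots,m\}$ in which every node has an optional left and an optional right child (distinguished); its size is its number of edges. Its minimal dag has one node per distinct subtree (subtree = a node with all its descendants) and, from the node of each distinct subtree, one edge to the node of each of its non-empty left/right subtrees; so its number of edges is the sum over distinct subtrees of the number of children of their root. $\bar E^{\mathcal B}_{m,n}$ is the average of this number over all $m$-labeled binary trees of size $n$. *)

(* Defs.v *)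
From HB Require Import structures.
From mathcomp Require Import all_boot.
From Stdlib Require Import Reals.

Set Implicit Arguments.
Unset Strict Implicit.
Unset Printing Implicit Defensive.

(* Binary trees with nat node labels; [Leaf] is the EMPTY tree (an absent
   child).  A non-empty binary tree is [Node a l r] with label [a],
   left subtree [l] and right subtree [r] (each possibly empty). *)
Inductive bt : Type :=
| Leaf : bt
| Node : nat -> bt -> bt -> bt.

Fixpoint bt_eqb (s t : bt) : bool :=
  match s, t with
  | Leaf, Leaf => true
  | Node a l r, Node b l' r' => (a == b) && bt_eqb l l' && bt_eqb r r'
  | _, _ => false
  end.

Lemma bt_eqP : Equality.axiom bt_eqb.
Proof.
elim=> [|a l IHl r IHr] [|b l' r'] /=; try by constructor.
case: eqP => [<-|neq]; last by constructor; case.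
case: IHl => [<-|neq]; last by constructor; case.
case: IHr => [<-|neq]; last by constructor; case.
by constructor.
Qed.

HB.instance Definition _ := hasDecEq.Build bt bt_eqP.

Fixpoint nodes (t : bt) : nat :=
  match t with Leaf => 0 | Node _ l r => (nodes l + nodes r).+1 end.

(* size of a (non-empty) tree = number of edges = nodes - 1 *)
Definition bt_size (t : bt) : nat := (nodes t).-1.

Fixpoint labeled (m : nat) (t : bt) : bool :=
  match t with
  | Leaf => true
  | Node a l r => [&& 1 <= a <= m, labeled m l & labeled m r]
  end.

Fixpoint subtrees (t : bt) : seq bt :=
  match t with
  | Leaf => [::]
  | Node _ l r => t :: (subtrees l ++ subtrees r)
  end.

Definition nchildren (t : bt) : nat :=
  match t with
  | Leaf => 0
  | Node _ l r => (l != Leaf) + (r != Leaf)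
  end.

(* number of edges of the minimal dag: sum over DISTINCT subtrees of the
   number of children of their root *)
Definition dag_edges (t : bt) : nat :=
  sumn [seq nchildren u | u <- undup (subtrees t)].

(* Explicit enumeration of all m-labeled binary trees with exactly k nodes
   (k = 0 gives the empty tree only).  [fuel] guarantees termination;
   fuel k.+1 is always enough. *)
Fixpoint trees_f (fuel m k : nat) : seq bt :=
  match fuel with
  | 0 => [::]
  | fuel'.+1 =>
    match k with
    | 0 => [:: Leaf]
    | k'.+1 =>
      flatten [seq flatten [seq flatten [seq [seq Node a l r | r <- trees_f fuel' m (k' - i)]
                                        | l <- trees_f fuel' m i]
                           | i <- iota 0 k'.+1]
              | a <- iota 1 m]
    end
  end.

Definition trees_nodes (m k : nat) : seq bt := trees_f k.+1 m k.

(* All m-labeled binary trees of size n (n edges, i.e. n+1 nodes). *)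
Definition trees_of_size (m n : nat) : seq bt := trees_nodes m n.+1.

Definition avg_dag_edges (m n : nat) : R :=
  (INR (sumn [seq dag_edges t | t <- trees_of_size m n])
   / INR (size (trees_of_size m n)))%R.

Definition kappa (m : nat) : R := sqrt (ln (4 * INR m) / PI).

(* Main.v *)
(* With N = n + 1 nodes and T_k = m^k Cat_k, a fixed tree with k nodes occurs
   m^(N-k) binom(2(N-k), N-k) times in total among all trees with N nodes.
   So a distinct subtree with k nodes contributes at most T_N, at most this
   number, and (Bonferroni) at least this number minus the number of pairs of
   occurrences.  Use the first bound for k < K and the others for k >= K, where
   (4m)^K <= n < (4m)^(K+1).  The sum over k >= K is summed in closed form, as
   (N + 1) sum_(K <= k <= N) Cat_k binom(2(N-k), N-k)
     = binom(2K, K) (2(N-K) + 1) binom(2(N-K), N-K),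
   while the part k < K and the pairs cost only a factor 1 + O(1/K).  Since a
   root has (3k - 3) / (2k - 1) children on average, the mean number of edges is
   3 n binom(2K, K) / 4^K (1 + O(1/K)), and Wallis' bounds on binom(2K, K)
   conclude. *)
Require Import Defs.
From mathcomp Require Import all_boot.
From Stdlib Require Import Reals Lra.
From mathcomp Require Import zify.
(* Restores the nat_scope notations, such as [^], that Reals overrides. *)
Import ssrnat.

(** * Central binomial coefficients and Catalan numbers: recurrences and convolutions *)

Definition cbin (k : nat) : nat := 'C(k.*2, k).
Definition catalan (k : nat) : nat := cbin k %/ k.+1.
(** The coefficient of [x^k] in [(1 - 4x)^(-3/2)]. Those of [B = (1 - 4x)^(-1/2)] are [cbin k],
    those of [C = (1 - sqrt(1 - 4x)) / (2x)] are [catalan k]; the convolutions below are identities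
    between these series. *)
Definition obin (k : nat) : nat := (k.*2.+1 * cbin k)%N.

Lemma cbin_gt0 k : (0 < cbin k)%N.
Proof. by rewrite bin_gt0 -addnn leq_addr. Qed.

Lemma cbinS k : (k.+1 * cbin k.+1 = 2 * obin k)%N.
Proof.
rewrite /obin /cbin doubleS.
have h1 := mul_bin_diag k.*2.+2 k.
have h2 := mul_bin_down k.*2.+1 k.
have h3 : (k.*2.+1 - k = k.+1)%N by lia.
rewrite /= in h1 h2; rewrite h3 in h2.
rewrite -h1 h2; lia.
Qed.

(** The division in [catalan] is exact: [k + 1] divides [k cbin k] by [mul_bin_left], and is coprime
    to [k]. *)
Lemma catalanE k : (k.+1 * catalan k = cbin k)%N.
Proof.
rewrite /catalan mulnC divnK //.
have h := mul_bin_left k.*2 k.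
have e : (k.*2 - k = k)%N by lia.
rewrite e in h.
rewrite -(@Gauss_dvdr _ k) //; last by rewrite coprimeSn.
by rewrite -h dvdn_mulr.
Qed.

Lemma catalanS k : (k.+2 * catalan k.+1 = (2 * k.*2.+1) * catalan k)%N.
Proof.
have h1 := catalanE k; have h2 := catalanE k.+1; have h3 := cbinS k.
rewrite /obin in h3.
apply/eqP; rewrite -(@eqn_pmul2l k.+1) //; apply/eqP; nia.
Qed.

Lemma obinS j : (j.+1 * obin j.+1 = 2 * (j.*2.+3) * obin j)%N.
Proof. have h := cbinS j; rewrite {1}/obin; nia. Qed.

(* The telescoping step of [sum_catalan_cbin_tail], with [N = K + j + 1]. *)
Lemma cbin_step K j :
  ((K + j).+2 * (catalan K * cbin j.+1) + cbin K.+1 * obin j = cbin K * obin j.+1)%N.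
Proof.
apply/eqP; rewrite -(@eqn_pmul2l K.+1) //; apply/eqP.
have h1 := catalanE K; have h2 := cbinS j; have h3 := cbinS K.
have -> : obin j.+1 = ((j.*2.+3) * cbin j.+1)%N by rewrite /obin; congr muln; lia.
rewrite {1}/obin in h3.
have -> : (K.+1 * ((K + j).+2 * (catalan K * cbin j.+1) + cbin K.+1 * obin j)
  = (K + j).+2 * ((K.+1 * catalan K) * cbin j.+1) + (K.+1 * cbin K.+1) * obin j)%N by nia.
rewrite h1 h3.
have -> : (2 * (K.*2.+1 * cbin K) * obin j = K.*2.+1 * cbin K * (2 * obin j))%N by nia.
rewrite -h2; nia.
Qed.

(** At fixed [N], passing from [K] to [K + 1] lowers the right-hand side by [N + 1] times the term
    [k = K], which is [cbin_step]. *)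
Lemma sum_catalan_cbin_tail N K : (K <= N)%N ->
  (N.+1 * \sum_(K <= k < N.+1) catalan k * cbin (N - k) = cbin K * obin (N - K))%N.
Proof.
move=> hK; have [j ->] : exists j, N = (K + j)%N by exists (N - K)%N; lia.
rewrite addKn; elim: j K {hK} => [|j IH] K.
  rewrite addn0 big_nat1 subnn mulnA catalanE.
  by rewrite /obin.
rewrite big_ltn; last by lia.
rewrite addKn mulnDr -addSnnS IH -cbin_step addSnnS addnS; lia.
Qed.

Lemma sum_catalan_cbin N :
  (N.+1 * \sum_(i < N.+1) catalan i * cbin (N - i) = obin N)%N.
Proof.
rewrite -(big_mkord xpredT (fun i => catalan i * cbin (N - i))%N).
by rewrite sum_catalan_cbin_tail // subn0 mul1n.
Qed.

Lemma sum_rev_conv (f g : nat -> nat) N :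
  (\sum_(i < N.+1) f i * g (N - i) = \sum_(i < N.+1) g i * f (N - i))%N.
Proof.
rewrite (reindex_inj rev_ord_inj) /=; apply: eq_bigr => i _.
by rewrite mulnC subSS subKn // -ltnS.
Qed.

(** In series, [B = 1 + 2x B C]. *)
Lemma cbin_conv N : (cbin N.+1 = 2 * \sum_(i < N.+1) cbin i * catalan (N - i))%N.
Proof.
rewrite -(sum_rev_conv catalan).
have h1 := sum_catalan_cbin N; have h2 := cbinS N.
apply/eqP; rewrite -(@eqn_pmul2l N.+1) //; apply/eqP; nia.
Qed.

(** Add the sum in [cbin_conv] to its reflection: the weights [i + 1] and [N - i + 1] turning
    [catalan] into [cbin] add up to [N + 2]. *)
Lemma catalan_conv N : (catalan N.+1 = \sum_(i < N.+1) catalan i * catalan (N - i))%N.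
Proof.
apply/eqP; rewrite -(@eqn_pmul2l N.+2) //; apply/eqP.
rewrite catalanE cbin_conv mul2n -addnn {1}sum_rev_conv -big_split big_distrr /=.
apply: eq_bigr => i _.
have := ltn_ord i; rewrite ltnS; move: (nat_of_ord i) => {}i /subnK.
move: (N - i)%N => j <-.
have h1 := catalanE i; have h2 := catalanE j; nia.
Qed.

(* By symmetry [N S_N = 2 sum_i i cbin i cbin (N - i)], whence [S_(N+1) = 4 S_N]. *)
Lemma cbin_cbin_conv N : (\sum_(i < N.+1) cbin i * cbin (N - i) = 4 ^ N)%N.
Proof.
elim: N => [|N IH]; first by rewrite big_ord1.
pose S N := (\sum_(i < N.+1) cbin i * cbin (N - i))%N.
have sym M : (M * S M = 2 * \sum_(i < M.+1) i * cbin i * cbin (M - i))%N.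
  rewrite mul2n -addnn.
  rewrite {1}(sum_rev_conv (fun i => i * cbin i)%N) -big_split big_distrr /=.
  apply: eq_bigr => i _; have := ltn_ord i; rewrite ltnS.
  move: (nat_of_ord i) => {}i /subnK; move: (M - i)%N => j <-; lia.
apply/eqP; rewrite -(@eqn_pmul2l N.+1) // -/(S N.+1) sym big_ord_recl /= mul0n add0n.
have -> : (\sum_(i < N.+1) bump 0 i * cbin (bump 0 i) * cbin (N.+1 - bump 0 i) =
  4 * \sum_(i < N.+1) i * cbin i * cbin (N - i) + 2 * \sum_(i < N.+1) cbin i * cbin (N - i))%N.
  rewrite !big_distrr -big_split /=; apply: eq_bigr => i _.
  rewrite /bump leq0n add1n subSS cbinS /obin; lia.
have := sym N; rewrite /S IH expnS => h; apply/eqP; nia.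
Qed.

(** In series, [D (1 - 2x C) = 1 / (1 - 4x)] for [D = (1 - 4x)^(-3/2)]. With [j = N - i], it follows
    from [(2i + 1) + 2 (j + 1) = 2N + 3], [cbin_cbin_conv] and [cbin_conv]. *)
Lemma obin_conv N :
  (obin N.+1 = 4 ^ N.+1 + 2 * \sum_(i < N.+1) obin i * catalan (N - i))%N.
Proof.
have h : (\sum_(i < N.+1) obin i * catalan (N - i) + 2 * 4 ^ N
   = N.*2.+3 * \sum_(i < N.+1) cbin i * catalan (N - i))%N.
  rewrite -cbin_cbin_conv !big_distrr -big_split /=; apply: eq_bigr => i _.
  have := ltn_ord i; rewrite ltnS; move: (nat_of_ord i) => {}i /subnK.
  move: (N - i)%N => j <-.
  have h2 := catalanE j; rewrite /obin; nia.
have h1 := cbin_conv N; rewrite {1}/obin h1 expnS; nia.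
Qed.

Lemma obin_mul4 j : (4 * obin j <= obin j.+1)%N.
Proof.
have h := obinS j; rewrite -(@leq_pmul2l j.+1) // h; nia.
Qed.

Lemma obin_exp4 i j : (4 ^ i * obin j <= obin (i + j))%N.
Proof.
elim: i => [|i IH]; first by rewrite mul1n.
rewrite addSn; apply: leq_trans (obin_mul4 _); rewrite expnS; lia.
Qed.

(** For [j > 0], [obin j / (j 4^j)] does not increase with [j]. With [obin_exp4], this puts
    [obin (i + j) / (4^i obin j)] between [1] and [(i + j) / j]. *)
Lemma obin_exp4_lower i j : (j * obin (i + j) <= (i + j) * (4 ^ i * obin j))%N.
Proof.
elim: i => [|i IH]; first by rewrite mul1n.
rewrite addSn expnS; have := obinS (i + j).
set d := obin (i + j) in IH *; set d' := obin _.+1; set e := (4 ^ i * _)%N in IH *.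
move=> h.
rewrite -(@leq_pmul2l (i + j).+1) // mulnCA h.
have : (j * (2 * (i + j).*2.+3 * d) <= 2 * (i+j).*2.+3 * ((i + j) * e))%N by nia.
rewrite -mulnA -/e; nia.
Qed.

Lemma cbin_le4 k : (cbin k.+1 <= 4 * cbin k)%N.
Proof. have := cbinS k; rewrite -(@leq_pmul2l k.+1) // /obin; nia. Qed.

(** * The enumeration of labeled trees and sums over it *)

Lemma trees_fS fuel m k : trees_f fuel.+1 m k.+1 =
  flatten [seq flatten [seq flatten [seq [seq Node a l r | r <- trees_f fuel m (k - i)]
                                    | l <- trees_f fuel m i]
                       | i <- iota 0 k.+1]
          | a <- iota 1 m].
Proof. by []. Qed.

Lemma big_trees_f fuel m k (F : bt -> nat) :
  (\sum_(t <- trees_f fuel.+1 m k.+1) F t =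
   \sum_(a <- iota 1 m) \sum_(i < k.+1) \sum_(l <- trees_f fuel m i)
     \sum_(r <- trees_f fuel m (k - i)) F (Node a l r))%N.
Proof.
rewrite trees_fS big_flatten big_map; apply: eq_bigr => a _.
rewrite -(big_mkord xpredT (fun i => \sum_(l <- trees_f fuel m i)
     \sum_(r <- trees_f fuel m (k - i)) F (Node a l r)))%N.
rewrite /index_iota subn0 big_flatten big_map.
apply: eq_bigr => i _; rewrite big_flatten big_map; apply: eq_bigr => l _.
by rewrite big_map.
Qed.

Lemma mem_trees_f fuel m k t : (k < fuel)%N ->
  (t \in trees_f fuel m k) = labeled m t && (nodes t == k).
Proof.
elim: fuel k t => [//|fuel IH] [|k] t hk; first by case: t => [|a l r]; rewrite ?andbF.
rewrite trees_fS; apply/flatten_mapP/idP => [[a ha /flatten_mapP[i hi /flatten_mapP[l hl /mapP[r hr ->]]]]|].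
  move: ha hi; rewrite !mem_iota => ha hi.
  move: hl hr; rewrite !IH; try lia.
  by move=> /= /andP[-> /eqP->] /andP[-> /eqP->]; lia.
case: t => [//|a l r]; rewrite [labeled _ _]/= => /andP[/and3P[ha hl hr] /eqP[hn]].
exists a; first by rewrite mem_iota; lia.
apply/flatten_mapP; exists (nodes l); first by rewrite mem_iota; lia.
apply/flatten_mapP; exists l; first by rewrite IH ?hl ?eqxx //; lia.
apply/mapP; exists r => //; rewrite IH; last by lia.
by rewrite hr; apply/eqP; lia.
Qed.

Lemma flatten_map_uniq (A B : eqType) (f : A -> seq B) (s : seq A) :
  uniq s -> (forall a, a \in s -> uniq (f a)) ->
  (forall a b x, a \in s -> b \in s -> x \in f a -> x \in f b -> a = b) ->
  uniq [seq y | x <- s, y <- f x].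
Proof.
move=> us uf inj; apply: allpairs_uniq_dep => //.
move=> [a x] [b y] /allpairsPdep[a' [x' [ha hx [-> ->]]]].
move=> /allpairsPdep[b' [y' [hb hy [-> ->]]]] /= e; subst y'.
by rewrite (inj _ _ _ ha hb hx hy).
Qed.

Lemma trees_f_uniq fuel m k : (k < fuel)%N -> uniq (trees_f fuel m k).
Proof.
elim: fuel k => [//|fuel IH] [//|k] hk; rewrite trees_fS.
have flE (A B : Type) (f : A -> seq B) s :
  flatten [seq f x | x <- s] = [seq y | x <- s, y <- f x].
  by congr flatten; apply: eq_map => x; rewrite map_id.
rewrite flE; apply: flatten_map_uniq; first exact: iota_uniq; last first.
  by move=> a b x _ _ /flatten_mapP[i _ /flatten_mapP[l _ /mapP[r _ ->]]]
    /flatten_mapP[i' _ /flatten_mapP[l' _ /mapP[r' _ [-> _ _]]]].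
move=> a _; rewrite flE; apply: flatten_map_uniq; first exact: iota_uniq; last first.
  move=> i j x; rewrite !mem_iota => hi hj.
  move=> /flatten_mapP[l hl /mapP[r _ ->]] /flatten_mapP[l' hl' /mapP[r' _ [el _]]].
  move: hl hl'; rewrite el !mem_trees_f; lia.
move=> i; rewrite mem_iota => hi; rewrite flE; apply: flatten_map_uniq; last first.
- by move=> l l' x _ _ /mapP[r _ ->] /mapP[r' _ [-> _]].
- by move=> l _; rewrite map_inj_uniq ?IH //; [lia|move=> r r' []].
- by apply: IH; lia.
Qed.

Lemma mem_trees_nodes m k t :
  (t \in trees_nodes m k) = labeled m t && (nodes t == k).
Proof. exact: mem_trees_f. Qed.

Lemma trees_nodes_uniq m k : uniq (trees_nodes m k).
Proof. exact: trees_f_uniq. Qed.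

Lemma big_trees_nodes m k (F : bt -> nat) :
  (\sum_(t <- trees_nodes m k.+1) F t =
   \sum_(a <- iota 1 m) \sum_(i < k.+1) \sum_(l <- trees_nodes m i)
     \sum_(r <- trees_nodes m (k - i)) F (Node a l r))%N.
Proof.
(* Any sufficient fuel gives a duplicate-free list of the same trees, so sums do not depend on
   it. *)
have perm fuel j : (j < fuel)%N -> perm_eq (trees_f fuel m j) (trees_nodes m j).
  move=> hj; apply: uniq_perm; [exact: trees_f_uniq|exact: trees_nodes_uniq|].
  by move=> t; rewrite mem_trees_nodes mem_trees_f.
rewrite [LHS]big_trees_f; apply: eq_bigr => a _; apply: eq_bigr => i _.
rewrite (perm_big _ (perm _ _ (ltn_ord i))) /=.
apply: eq_bigr => l _; have hki : (k - i < k.+1)%N by lia.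
by rewrite (perm_big _ (perm _ _ hki)).
Qed.

(* Sums of additive tree parameters obey a linear recurrence with kernel [2 m T]. *)
Lemma big_trees_nodes_additive m k (F G H : bt -> nat) :
  (forall a l r, labeled m (Node a l r) -> nodes (Node a l r) = k.+1 ->
     F (Node a l r) = G l + G r + H (Node a l r))%N ->
  (\sum_(t <- trees_nodes m k.+1) F t =
   2 * m * \sum_(i < k.+1) (\sum_(t <- trees_nodes m i) G t) * size (trees_nodes m (k - i))
   + \sum_(t <- trees_nodes m k.+1) H t)%N.
Proof.
move=> hF.
rewrite (eq_big_seq (fun t => (if t is Node a l r then G l + G r else 0) + H t)%N); last first.
  by move=> [|a l r]; rewrite mem_trees_nodes => /andP[// hl /eqP hn]; rewrite hF.
rewrite big_split /=; congr addn; rewrite big_trees_nodes.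
rewrite big_const_seq count_predT size_iota iter_addn_0 mulnC [(2 * m)%N]mulnC -mulnA.
congr muln; rewrite mul2n -addnn.
(* Reflecting one copy of the convolution makes it the contribution of the right subtrees. *)
rewrite {2}(sum_rev_conv (fun i => \sum_(t <- trees_nodes m i) G t)%N (fun i => size (trees_nodes m i))).
rewrite -big_split /=; apply: eq_bigr => i _.
under eq_bigr => l _ do rewrite big_split /= big_const_seq count_predT iter_addn_0.
rewrite big_split /= -big_distrl /=; congr addn.
by rewrite big_const_seq count_predT iter_addn_0 mulnC.
Qed.

Lemma size_trees_nodes m k : size (trees_nodes m k) = (m ^ k * catalan k)%N.
Proof.
elim/ltn_ind: k => -[|k] IH; first by [].
have -> : size (trees_nodes m k.+1) = (\sum_(t <- trees_nodes m k.+1) 1)%N.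
  by rewrite sum1_size.
rewrite big_trees_nodes big_const_seq count_predT size_iota iter_addn_0 mulnC expnS -mulnA.
congr muln; rewrite catalan_conv big_distrr /=; apply: eq_bigr => i _.
have hi := ltn_ord i.
under eq_bigr => l _ do rewrite sum1_size.
rewrite big_const_seq count_predT iter_addn_0 !IH; try lia.
have -> : (m ^ k = m ^ i * m ^ (k - i))%N by rewrite -expnD subnKC.
lia.
Qed.

(** * Occurrences, and pairs of occurrences, of a fixed subtree *)

Lemma subtreesP m t u : labeled m t -> u \in subtrees t ->
  labeled m u && (0 < nodes u <= nodes t)%N.
Proof.
elim: t => [//|a l IHl r IHr] ht; rewrite inE => /orP[/eqP->|]; first by rewrite ht /=.
move: ht => /= /and3P[_ hl hr]; rewrite mem_cat => /orP[/(IHl hl)|/(IHr hr)]; lia.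
Qed.

Definition occ (u t : bt) : nat := count_mem u (subtrees t).

Lemma occ_small u t : (nodes t < nodes u)%N -> occ u t = 0%N.
Proof.
elim: t => [//|a l IHl r IHr] /= h; rewrite /occ /= count_cat -!/(occ u _) IHl ?IHr; try lia.
by rewrite !addn0; case: eqP => // e; rewrite -e /= ltnn in h.
Qed.

Lemma occ_node u a l r : occ u (Node a l r) = (occ u l + occ u r + (Node a l r == u))%N.
Proof. by rewrite /occ /= count_cat addnC. Qed.

(** A pair lies in [l], in [r], or has one member in each. The root belongs to no pair: if it
    carries an occurrence, the whole tree is [u], and neither child contains [u]. *)
Lemma occ2_node u a l r :
  'C(occ u (Node a l r), 2) = ('C(occ u l, 2) + 'C(occ u r, 2) + occ u l * occ u r)%N.
Proof.
have binD x y : ('C(x + y, 2) = 'C(x, 2) + 'C(y, 2) + x * y)%N.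
  elim: x => [|x IH]; first by rewrite addn0.
  by rewrite addSn !binS !bin1 IH; lia.
rewrite occ_node; case: eqP => [<-|_]; last by rewrite addn0 binD.
by rewrite !occ_small //=; lia.
Qed.

Lemma mem_occ u t : (u \in subtrees t) <= occ u t.
Proof. by rewrite /occ -has_pred1 has_count; case: count. Qed.

Lemma occ_bonferroni u t : (occ u t <= (u \in subtrees t) + 'C(occ u t, 2))%N.
Proof.
rewrite /occ -has_pred1 has_count; case: count => [//|x].
by rewrite binS bin1 add1n ltnS leq_addl.
Qed.

Lemma sum_occ_small m N u : (N < nodes u)%N ->
  (\sum_(t <- trees_nodes m N) occ u t = 0)%N.
Proof.
move=> h; rewrite big_seq big1 // => t; rewrite mem_trees_nodes => /andP[_ /eqP e].
by rewrite occ_small ?e.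
Qed.

(** The additive recurrence has as its only source the tree [u] itself, at [j = 0]; its solution is
    then the one of [cbin_conv], scaled by [m^j]. *)
Lemma sum_occ m u j : labeled m u -> (0 < nodes u)%N ->
  (\sum_(t <- trees_nodes m (nodes u + j)) occ u t = m ^ j * cbin j)%N.
Proof.
move=> hu; case e : (nodes u) => [//|k] _; elim/ltn_ind: j => j IH.
rewrite addSn (@big_trees_nodes_additive _ _ _ (occ u) (fun t => t == u : nat)); last first.
  by move=> a l r _ _; exact: occ_node.
rewrite -addSn big_split_ord /= big1 ?add0n => [|i _]; last first.
  by rewrite sum_occ_small ?e.
have -> : (\sum_(t <- trees_nodes m (k.+1 + j)) (t == u) = (j == 0))%N.
  rewrite -big_mkcond sum1_count /= count_uniq_mem ?trees_nodes_uniq //.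
  by rewrite mem_trees_nodes hu e /=; lia.
case: j IH => [|j] IH; first by rewrite big_ord0 muln0.
rewrite addn0 cbin_conv expnS.
rewrite (eq_bigr (fun i : 'I_j.+1 => m ^ j * (cbin i * catalan (j - i)))%N) => [|i _].
  by rewrite -big_distrr /=; lia.
have hi := ltn_ord i.
rewrite IH // size_trees_nodes; have -> : (k + j.+1 - (k.+1 + i) = j - i)%N by lia.
have -> : (m ^ j = m ^ i * m ^ (j - i))%N by rewrite -expnD subnKC.
lia.
Qed.

(** Two occurrences of one tree are disjoint and lie below a common ancestor, so a pair takes at
    least [2 nodes u + 1] nodes. *)
Lemma sum_occ2_small m N u : (N <= (nodes u).*2)%N ->
  (\sum_(t <- trees_nodes m N) 'C(occ u t, 2) = 0)%N.
Proof.
elim/ltn_ind: N => -[|N] IH hN; first by rewrite /trees_nodes /= big_seq1.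
rewrite (@big_trees_nodes_additive _ _ _ (fun t => 'C(occ u t, 2))
  (fun t => if t is Node _ l r then occ u l * occ u r else 0)%N); last first.
  by move=> a l r _ _; exact: occ2_node.
rewrite big1 => [|i _]; last first.
  by have := ltn_ord i; move=> hi; rewrite IH //; lia.
rewrite muln0 big_seq big1 // => -[//|a l r]; rewrite mem_trees_nodes => /andP[_ /eqP /= e].
have [h|h] := ltnP (nodes l) (nodes u); first by rewrite occ_small.
by rewrite mulnC occ_small //; lia.
Qed.

(** The source of the recurrence is now the number of pairs split by the root, [m^(j+1) 4^j] by
    [sum_occ] and [cbin_cbin_conv]; [obin_conv] solves it. *)
Lemma sum_occ2 m u j : labeled m u -> (0 < nodes u)%N ->
  (\sum_(t <- trees_nodes m ((nodes u).*2.+1 + j)) 'C(occ u t, 2) = m ^ j.+1 * obin j)%N.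
Proof.
move=> hu; set k := nodes u => k0; elim/ltn_ind: j => j IH.
rewrite addSn (@big_trees_nodes_additive _ _ _ (fun t => 'C(occ u t, 2))
  (fun t => if t is Node _ l r then occ u l * occ u r else 0)%N); last first.
  by move=> a l r _ _; exact: occ2_node.
rewrite big_trees_nodes big_const_seq count_predT size_iota iter_addn_0.
rewrite -[(k.*2 + j).+1]addSn big_split_ord /= big1 ?add0n => [|i _]; last first.
  by rewrite sum_occ2_small // -ltnS.
have -> : (\sum_(i < k.*2.+1 + j) \sum_(l <- trees_nodes m i)
    \sum_(r <- trees_nodes m (k.*2 + j - i)) occ u l * occ u r = m ^ j * 4 ^ j)%N.
  under eq_bigr => i _ do under eq_bigr => l _ do rewrite -big_distrr /=.
  under eq_bigr => i _ do rewrite -big_distrl /=.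
  (* The first [k] values of [i] leave the left subtree too small to contain [u], the last [k] the
     right one. *)
  have -> : (k.*2.+1 + j)%N = (k + (j.+1 + k))%N by lia.
  rewrite big_split_ord /= big1 ?add0n => [|i _]; last by rewrite sum_occ_small.
  rewrite big_split_ord /= [X in (_ + X)%N]big1 ?addn0 => [|i _]; last first.
    by rewrite [X in (_ * X)%N]sum_occ_small ?muln0 // -/k; have := ltn_ord i; lia.
  rewrite -cbin_cbin_conv big_distrr /=; apply: eq_bigr => i _.
  have hi := ltn_ord i.
  have -> : (k.*2 + j - (k + i) = k + (j - i))%N by lia.
  rewrite !sum_occ //.
  have -> : (m ^ j = m ^ i * m ^ (j - i))%N by rewrite -expnD subnKC.
  lia.
case: j IH => [|j] IH; first by rewrite big_ord0 muln0 !expn0 -[obin 0]/1%N expn1 !muln1 mul1n.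
rewrite obin_conv.
rewrite (eq_bigr (fun i : 'I_j.+1 => m ^ j.+1 * (obin i * catalan (j - i)))%N) => [|i _].
  by rewrite -big_distrr /= [(m ^ j.+2)%N]expnS; lia.
have hi := ltn_ord i.
rewrite IH // size_trees_nodes; have -> : (k.*2 + j.+1 - (k.*2.+1 + i) = j - i)%N by lia.
have -> : (m ^ j.+1 = m ^ i.+1 * m ^ (j - i))%N by rewrite -expnD addSn subnKC.
lia.
Qed.

(** * Children of the root, and dag edges summed over possible subtrees *)

Definition root_edges (m k : nat) : nat := (\sum_(u <- trees_nodes m k) nchildren u)%N.

Lemma root_edges0 m : root_edges m 0 = 0%N.
Proof. by rewrite /root_edges /trees_nodes /= big_seq1. Qed.

(** Each of the two child slots of the root is empty in exactly [m T_k] trees. *)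
Lemma root_edgesS m k :
  (root_edges m k.+1 + 2 * m * size (trees_nodes m k) = 2 * size (trees_nodes m k.+1))%N.
Proof.
rewrite -[in RHS]sum1_size big_distrr /= muln1.
rewrite (@big_trees_nodes_additive _ _ (fun=> 2%N) (fun=> 1%N) (fun=> 0%N)) //.
rewrite /root_edges.
rewrite (@big_trees_nodes_additive _ _ _ (fun t => t != Leaf : nat) (fun=> 0%N)); last first.
  by move=> a l r _ _ /=; rewrite addn0.
have e0 : trees_nodes m (@ord0 k) = [:: Leaf] by [].
rewrite !big_ord_recl !e0 !big_seq1 subn0.
rewrite big1_eq !addn0 add0n mul1n mulnDr addnC; congr addn; congr muln.
apply: eq_bigr => i _; congr muln; apply: eq_big_seq => -[|//].
by rewrite mem_trees_nodes.
Qed.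

Lemma root_edgesE m k :
  (k.*2.+1 * root_edges m k.+1 = 3 * k * size (trees_nodes m k.+1))%N.
Proof.
have h := root_edgesS m k; rewrite !size_trees_nodes expnS in h *.
have := catalanS k; move: (catalan k) (catalan k.+1) (m ^ k)%N h => c c' M h e.
have : (M * m * (k.+2 * c') = M * m * (2 * k.*2.+1 * c))%N by rewrite e.
nia.
Qed.

Lemma dag_edgesE m N t : t \in trees_nodes m N ->
  dag_edges t = (\sum_(k < N.+1) \sum_(u <- trees_nodes m k) nchildren u * (u \in subtrees t))%N.
Proof.
rewrite mem_trees_nodes => /andP[ht /eqP hN]; rewrite /dag_edges sumnE big_map.
transitivity (\sum_(k < N.+1) \sum_(u <- undup (subtrees t) | nodes u == k) nchildren u)%N.
  rewrite (exchange_big_dep xpredT) //=; apply: eq_big_seq => u.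
  rewrite mem_undup => /(subtreesP _ _ _ ht) /andP[_ hu].
  have hu' : (nodes u < N.+1)%N by lia.
  by rewrite (big_pred1 (Ordinal hu')) // => i; rewrite -val_eqE /= eq_sym.
apply: eq_bigr => k _; rewrite -big_filter.
rewrite [RHS](eq_bigr (fun u => if u \in subtrees t then nchildren u else 0)%N); last first.
  by move=> u _; case: ifP; rewrite ?muln1 ?muln0.
rewrite -big_mkcond -[RHS]big_filter; apply: perm_big; apply: uniq_perm.
- by apply: filter_uniq; apply: undup_uniq.
- by apply: filter_uniq; apply: trees_nodes_uniq.
move=> u; rewrite !mem_filter mem_undup mem_trees_nodes.
case hu : (u \in subtrees t); last by rewrite andbF.
by have /andP[-> _] := subtreesP _ _ _ ht hu; rewrite andbT.
Qed.

Definition total_edges (m N : nat) : nat := (\sum_(t <- trees_nodes m N) dag_edges t)%N.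

Lemma total_edgesE m N :
  total_edges m N = (\sum_(k < N.+1) \sum_(u <- trees_nodes m k)
    nchildren u * \sum_(t <- trees_nodes m N) (u \in subtrees t))%N.
Proof.
rewrite /total_edges (eq_big_seq _ (@dag_edgesE m N)) exchange_big /=.
apply: eq_bigr => k _; rewrite exchange_big /=; apply: eq_bigr => u _.
by rewrite big_distrr.
Qed.

(** * Integer bounds on the total number of dag edges *)

Definition tree_count (m k : nat) : nat := size (trees_nodes m k).

Lemma tree_count_cbin m k : (k.+1 * tree_count m k = m ^ k * cbin k)%N.
Proof. by rewrite /tree_count size_trees_nodes mulnCA catalanE. Qed.

Lemma root_edges_le m k : (2 * root_edges m k <= 3 * tree_count m k)%N.
Proof.
case: k => [|k]; first by rewrite root_edges0.
have := root_edgesE m k; rewrite -/(tree_count _ _) => h.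
rewrite -(@leq_pmul2l k.*2.+1) //; nia.
Qed.

Lemma root_edges_ge m K k : (K <= k)%N ->
  (3 * K * tree_count m k.+1 <= K.*2.+1 * root_edges m k.+1)%N.
Proof.
move=> hK; have := root_edgesE m k; rewrite -/(tree_count _ _) => h.
rewrite -(@leq_pmul2l k.*2.+1) //.
rewrite [X in (_ <= X)%N]mulnCA h -!mulnA.
set t := tree_count _ _ in h *; nia.
Qed.

(** From [k = 1] on, [T_(k+1) >= (3/2) T_k], just enough for [2 T_k + T_k <= 2 T_(k+1)]. *)
Lemma sum_tree_count m K : (1 <= m)%N -> (1 <= K)%N ->
  (\sum_(0 <= k < K) tree_count m k <= 2 * tree_count m K)%N.
Proof.
move=> hm; case: K => [//|K] _; elim: K => [|K IH].
  by rewrite big_nat1 /tree_count !size_trees_nodes expn1 -[catalan 1]/1%N -[catalan 0]/1%N; lia.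
rewrite big_nat_recr //=; apply: leq_trans (leq_add IH (leqnn _)) _.
rewrite /tree_count !size_trees_nodes.
have h := catalanS K.+1; rewrite addnC -mulSn [(m ^ K.+2)%N]expnS.
have h2 : (3 * catalan K.+1 <= 2 * catalan K.+2)%N.
  rewrite -(@leq_pmul2l K.+3) // [X in (_ <= X)%N]mulnCA h.
  move: (catalan _) => c; nia.
rewrite mulnCA -!mulnA [X in (_ <= X)%N]mulnCA.
have : (m ^ K.+1 * (3 * catalan K.+1) <= m ^ K.+1 * (2 * catalan K.+2))%N by rewrite leq_mul2l h2 orbT.
move: (m ^ K.+1)%N (catalan K.+1) (catalan K.+2) => M c c'; nia.
Qed.

(* The number of pairs of occurrences of a fixed tree with [k] nodes in the trees
   with [N] nodes; see [sum_occ2]. *)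
Definition pairs (m N k : nat) : nat :=
  if (k.*2 < N)%N then (m ^ (N - k.*2) * obin (N - k.*2.+1))%N else 0%N.

Definition containing (m N : nat) (u : bt) : nat :=
  (\sum_(t <- trees_nodes m N) (u \in subtrees t))%N.

Lemma containing_le_total m N u : (containing m N u <= tree_count m N)%N.
Proof.
rewrite /containing /tree_count -sum1_size; apply: leq_sum => t _; exact: leq_b1.
Qed.

Lemma containing_le_occ m N u : labeled m u -> (0 < nodes u <= N)%N ->
  (containing m N u <= m ^ (N - nodes u) * cbin (N - nodes u))%N.
Proof.
move=> hu /andP[h0 hN]; rewrite -(sum_occ _ _ _ hu h0) subnKC //.
by apply: leq_sum => t _; exact: mem_occ.
Qed.

Lemma containing_bonferroni m N u : labeled m u -> (0 < nodes u <= N)%N ->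
  (m ^ (N - nodes u) * cbin (N - nodes u) <= containing m N u + pairs m N (nodes u))%N.
Proof.
move=> hu /andP[h0 hN]; rewrite -(sum_occ _ _ _ hu h0) subnKC //.
have -> : pairs m N (nodes u) = (\sum_(t <- trees_nodes m N) 'C(occ u t, 2))%N.
  rewrite /pairs; case: ltnP => [h|h]; last by rewrite sum_occ2_small.
  by have := sum_occ2 _ _ (N - (nodes u).*2.+1) hu h0; rewrite subnKC // subnSK.
by rewrite -big_split; apply: leq_sum => t _; exact: occ_bonferroni.
Qed.

(** Both factors [3] come from [root_edges_le]; the [6] has a further [2] from [sum_tree_count]. The
    terms [k >= K] are summed by [sum_catalan_cbin_tail]. *)
Lemma total_edges_upper m K N : (1 <= m)%N -> (1 <= K <= N)%N ->
  (2 * N.+1 * total_edges m N <=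
   6 * N.+1 * tree_count m K * tree_count m N + 3 * m ^ N * (cbin K * obin (N - K)))%N.
Proof.
move=> hm /andP[hK hKN].
rewrite total_edgesE -(big_mkord xpredT (fun k => \sum_(u <- trees_nodes m k)
    nchildren u * containing m N u)%N) (big_cat_nat (n := K)) //=; last by lia.
rewrite mulnDr; apply: leq_add.
  have h : (\sum_(0 <= k < K) \sum_(u <- trees_nodes m k) nchildren u * containing m N u
      <= \sum_(0 <= k < K) root_edges m k * tree_count m N)%N.
    apply: leq_sum => k _; rewrite /root_edges big_distrl /=.
    by apply: leq_sum => u _; rewrite leq_mul2l containing_le_total orbT.
  have h2 : (2 * \sum_(0 <= k < K) root_edges m k * tree_count m N <=
     3 * (\sum_(0 <= k < K) tree_count m k) * tree_count m N)%N.
    rewrite -big_distrl mulnA leq_mul2r /= !big_distrr /=.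
    by apply/orP; right; apply: leq_sum => k _; exact: root_edges_le.
  have := sum_tree_count m K hm hK.
  move: (\sum_(0 <= k < K) tree_count m k)%N (\sum_(0 <= k < K) root_edges m k * _)%N h h2 => s c h h2 h3.
  have h4 : (s * tree_count m N <= 2 * tree_count m K * tree_count m N)%N by rewrite leq_mul2r h3 orbT.
  set x := (\sum_(0 <= k < K) _)%N in h *.
  have h5 : (2 * x <= 6 * tree_count m K * tree_count m N)%N by lia.
  have := leq_mul (leqnn N.+1) h5; lia.
rewrite -sum_catalan_cbin_tail //.
set B := (\sum_(K <= k < N.+1) _)%N; set S := (\sum_(K <= k < N.+1) _)%N.
suff h : (2 * B <= 3 * m ^ N * S)%N by have := leq_mul (leqnn N.+1) h; lia.
rewrite /B /S !big_distrr /= big_nat_cond [X in (_ <= X)%N]big_nat_cond.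
apply: leq_sum => k /andP[/andP[hk hkN] _].
have h : (\sum_(u <- trees_nodes m k) nchildren u * containing m N u
   <= root_edges m k * (m ^ (N - k) * cbin (N - k)))%N.
  rewrite /root_edges big_distrl /= big_seq [X in (_ <= X)%N]big_seq; apply: leq_sum => u.
  rewrite mem_trees_nodes => /andP[hu /eqP e].
  rewrite leq_mul2l; apply/orP; right; rewrite -e; apply: containing_le_occ => //; lia.
have := leq_mul (root_edges_le m k) (leqnn (m ^ (N - k) * cbin (N - k))%N).
rewrite /tree_count size_trees_nodes.
have -> : (m ^ N = m ^ k * m ^ (N - k))%N by rewrite -expnD subnKC.
lia.
Qed.

Lemma total_edges_lower m K N : (1 <= K <= N)%N ->
  (\sum_(K <= k < N.+1) root_edges m k * (m ^ (N - k) * cbin (N - k)) <=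
   total_edges m N + \sum_(K <= k < N.+1) root_edges m k * pairs m N k)%N.
Proof.
move=> /andP[hK hKN].
rewrite total_edgesE -(big_mkord xpredT (fun k => \sum_(u <- trees_nodes m k)
    nchildren u * containing m N u)%N) (big_cat_nat (n := K) (leq0n K)) //=; last by lia.
rewrite -addnA; apply: leq_trans (leq_addl _ _); rewrite -big_split /=.
rewrite big_nat_cond [X in (_ <= X)%N]big_nat_cond.
apply: leq_sum => k /andP[/andP[hk hkN] _].
rewrite /root_edges !big_distrl -big_split /= big_seq [X in (_ <= X)%N]big_seq; apply: leq_sum => u.
rewrite mem_trees_nodes => /andP[hu /eqP e].
rewrite -mulnDr leq_mul2l; apply/orP; right; rewrite -e; apply: containing_bonferroni => //; lia.
Qed.

(** The sum starts at [K + 1] because a root in a tree with [k + 1] nodes, [k >= K], has on average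
    at least [3K / (2K + 1)] children. *)
Lemma expected_edges_lower m K N : (K < N)%N ->
  (3 * K * m ^ N * (cbin K.+1 * obin (N - K.+1)) <=
   K.*2.+1 * N.+1 * \sum_(K.+1 <= k < N.+1) root_edges m k * (m ^ (N - k) * cbin (N - k)))%N.
Proof.
move=> hK; rewrite -sum_catalan_cbin_tail //.
set B := (\sum_(_ <= k < _) _)%N; set S := (\sum_(_ <= k < _) _)%N.
suff h : (3 * K * m ^ N * B <= K.*2.+1 * S)%N by have := leq_mul (leqnn N.+1) h; lia.
rewrite /B /S !big_distrr /= big_nat_cond [X in (_ <= X)%N]big_nat_cond.
apply: leq_sum => -[|k] /andP[/andP[hk hkN] _] //.
have := leq_mul (root_edges_ge m K k hk) (leqnn (m ^ (N - k.+1) * cbin (N - k.+1))%N).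
rewrite /tree_count size_trees_nodes.
have -> : (m ^ N = m ^ k.+1 * m ^ (N - k.+1))%N by rewrite -expnD subnKC.
lia.
Qed.

(** Pairs cost a factor of order [(4m)^(-k)]: [obin_exp4] gives
    [4^(2k+1) obin (N - 2k - 1) <= obin N]. *)
Lemma pairs_term m N k :
  (4 * (4 * m) ^ k * 4 ^ k * k.+1 * (tree_count m k * pairs m N k) <= cbin k * m ^ N * obin N)%N.
Proof.
rewrite /pairs; case: ltnP => h; last by rewrite !muln0.
have e := tree_count_cbin m k; have := obin_exp4 k.*2.+1 (N - k.*2.+1).
rewrite subnKC // expnS -addnn expnD expnMn addnn => h4.
have -> : (m ^ N = m ^ k * m ^ k * m ^ (N - k.*2))%N by rewrite -!expnD addnn subnKC // ltnW.
have -> : (4 * (4 ^ k * m ^ k) * 4 ^ k * k.+1 * (tree_count m k * (m ^ (N - k.*2) * obin (N - k.*2.+1)))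
  = m ^ k * m ^ (N - k.*2) * (k.+1 * tree_count m k) * (4 * (4 ^ k * 4 ^ k) * obin (N - k.*2.+1)))%N by lia.
rewrite e.
have -> : (cbin k * (m ^ k * m ^ k * m ^ (N - k.*2)) * obin N =
  m ^ k * m ^ (N - k.*2) * (m ^ k * cbin k) * obin N)%N by lia.
by rewrite leq_mul2l h4 orbT.
Qed.

(** The bounds of [pairs_term] decrease at least by a factor [4] from [k] to [k + 1], so the tail is
    at most [4/3] of its first bound; this turns the constant [4] into [3]. *)
Lemma sum_pairs m N K : (1 <= m)%N ->
  (3 * ((4 * m) ^ K * 4 ^ K * K.+1) * \sum_(K <= k < N.+1) tree_count m k * pairs m N k
     <= cbin K * m ^ N * obin N)%N.
Proof.
move=> hm; have [hK|hK] := leqP N.+1 K; first by rewrite big_geq ?muln0.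
have [d e] : exists d, (K + d = N.+1)%N by exists (N.+1 - K)%N; lia.
elim: d K e {hK} => [|d IH] K e; first by rewrite big_geq ?muln0 //; lia.
rewrite big_ltn; last by lia.
have h1 := pairs_term m N K.
have := IH K.+1; rewrite addSnnS => /(_ e).
set s := (\sum_(_ <= k < _) _)%N.
have hc := leq_mul (cbin_le4 K) (leqnn (m ^ N * obin N)%N).
rewrite !expnS => h2.
set A := ((4 * m) ^ K * 4 ^ K)%N in h1 h2 *.
have h3 : (48 * (A * K.+1 * s) <= 3 * (4 * m * (4 * m) ^ K * (4 * 4 ^ K) * K.+2) * s)%N.
  rewrite (_ : 3 * (4 * m * (4 * m) ^ K * (4 * 4 ^ K) * K.+2) * s = A * s * (48 * m * K.+2))%N; last by rewrite /A; lia.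
  rewrite (_ : 48 * (A * K.+1 * s) = A * s * (48 * K.+1))%N; last by lia.
  rewrite leq_mul2l; apply/orP; right; nia.
have h4 : (4 * (A * K.+1 * (tree_count m K * pairs m N K)) <= cbin K * m ^ N * obin N)%N.
  by move: h1; rewrite /A; lia.
have h5 : (48 * (A * K.+1 * s) <= 4 * (cbin K * m ^ N * obin N))%N by lia.
move: h4 h5; move: (A * K.+1)%N (tree_count m K * _)%N (cbin K * _ * _)%N => B x y. lia.
Qed.

From Coquelicot Require Import Coquelicot.
Import ssrnat.

(** * Wallis integrals and bounds on the central binomial coefficient *)

Section Wallis.
Local Open Scope R_scope.

Definition wallis (n : nat) : R := RInt (fun x => sin x ^ n) 0 (PI / 2).

Lemma ex_RInt_sin_pow n : ex_RInt (fun x => sin x ^ n) 0 (PI / 2).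
Proof.
apply: ex_RInt_continuous => x _.
by apply: ex_derive_continuous; auto_derive.
Qed.

(** The difference of the integrands is the derivative of [- cos x sin^(n+1) x], which vanishes at
    both ends. *)
Lemma wallisSS n : (INR n + 2) * wallis n.+2 = (INR n + 1) * wallis n.
Proof.
pose f x := (INR n + 2) * sin x ^ n.+2 - (INR n + 1) * sin x ^ n.
have h1 : is_RInt f 0 (PI / 2) 0.
  pose g x := - cos x * sin x ^ n.+1.
  have e : minus (g (PI / 2)) (g 0) = 0.
    by rewrite /g cos_PI2 sin_0 /minus /plus /opp /=; ring.
  rewrite -[X in is_RInt _ _ _ X]e; apply: is_RInt_derive => x _.
    rewrite /g; auto_derive => //.
    have hc : cos x * cos x = 1 - sin x * sin x.
      by have := sin2_cos2 x; rewrite /Rsqr; lra.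
    rewrite -/(INR n.+1) /f S_INR /=.
    transitivity (sin x * (sin x * sin x ^ n) - (INR n + 1) * (cos x * cos x) * sin x ^ n).
      ring.
    by rewrite hc; ring.
  by apply: ex_derive_continuous; rewrite /f; auto_derive.
have h2 : is_RInt f 0 (PI / 2) ((INR n + 2) * wallis n.+2 - (INR n + 1) * wallis n).
  by apply: is_RInt_minus; apply: is_RInt_scal; apply: RInt_correct; exact: ex_RInt_sin_pow.
have := is_RInt_unique _ _ _ _ h1; rewrite (is_RInt_unique _ _ _ _ h2); lra.
Qed.

Lemma wallis0 : wallis 0 = PI / 2.
Proof. by rewrite /wallis RInt_const /scal /= /mult /=; ring. Qed.

Lemma wallis1 : wallis 1 = 1.
Proof.
rewrite /wallis; apply: is_RInt_unique.
pose g x := - cos x.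
have e : minus (g (PI / 2)) (g 0) = 1.
  by rewrite /g cos_PI2 cos_0 /minus /plus /opp /=; ring.
rewrite -[X in is_RInt _ _ _ X]e; apply: is_RInt_derive => x _.
  by rewrite /g; auto_derive => //; ring.
by apply: ex_derive_continuous; auto_derive.
Qed.

Lemma wallis_decr n : wallis n.+1 <= wallis n.
Proof.
have hpi := PI_RGT_0.
apply: RInt_le; [lra|exact: ex_RInt_sin_pow|exact: ex_RInt_sin_pow|].
move=> x hx; have h0 : 0 <= sin x by apply: sin_ge_0; lra.
have h1 := SIN_bound x; rewrite /=.
have : 0 <= sin x ^ n by apply: pow_le.
nra.
Qed.

Definition cbinR (k : nat) : R := INR (cbin k) / 4 ^ k.

Lemma cbinR_gt0 k : 0 < cbinR k.
Proof.
apply: Rdiv_lt_0_compat; last by apply: pow_lt; lra.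
by apply: lt_0_INR; apply/ltP; exact: cbin_gt0.
Qed.

Lemma cbinRS k : (2 * INR k + 2) * cbinR k.+1 = (2 * INR k + 1) * cbinR k.
Proof.
have h := cbinS k; rewrite /obin -mul2n in h.
have {h} := f_equal INR h.
rewrite !mult_INR -/(INR 2) !S_INR mult_INR /= => h.
have p : 4 ^ k <> 0 by apply: pow_nonzero; lra.
have -> : cbinR k.+1 = INR (cbin k.+1) / (4 * 4 ^ k) by [].
transitivity (2 * ((INR k + 1) * INR (cbin k.+1)) / (4 * 4 ^ k)); first by field.
by rewrite h /cbinR; field.
Qed.

Lemma wallis_even k : wallis (2 * k) = PI / 2 * cbinR k.
Proof.
elim: k => [|k IH]; first by rewrite wallis0 /cbinR /=; field.
have h := wallisSS (2 * k); rewrite IH in h.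
have := cbinRS k; rewrite mulnS add2n.
rewrite mult_INR /= in h.
have hk := pos_INR k; have hb := cbinR_gt0 k.
move=> h2; apply: (Rmult_eq_reg_l (2 * INR k + 2)); last lra.
transitivity ((2 * INR k + 1) * (PI / 2 * cbinR k)); first by rewrite -h; ring.
by transitivity (PI / 2 * ((2 * INR k + 1) * cbinR k)); [ring|rewrite -h2; ring].
Qed.

Lemma wallis_odd k : wallis (2 * k).+1 * ((2 * INR k + 1) * cbinR k) = 1.
Proof.
elim: k => [|k IH]; first by rewrite wallis1 /cbinR /=; field.
have h := wallisSS (2 * k).+1; rewrite S_INR mult_INR /= in h.
rewrite mulnS add2n S_INR.
have h2 := cbinRS k; rewrite -[RHS]IH.
have hk := pos_INR k.
have -> : 2 * (INR k + 1) + 1 = 2 * INR k + 1 + 2 by ring.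
have h' : (2 * INR k + 1 + 2) * wallis (2 * k).+3 = (2 * INR k + 2) * wallis (2 * k).+1.
  by transitivity (((1 + 1) * INR k + 1 + 2) * wallis (2 * k).+3); [ring|rewrite h; ring].
rewrite (_ : _ * _ = (2 * INR k + 1 + 2) * wallis (2 * k).+3 * cbinR k.+1); last by ring.
rewrite h' (_ : _ * _ = wallis (2 * k).+1 * ((2 * INR k + 2) * cbinR k.+1)); last by ring.
by rewrite h2.
Qed.

(** This is [W_(2k+1) <= W_(2k)]; the next lemma is [W_(2k) <= W_(2k-1)]. *)
Lemma cbinR_sqr_ge k : 1 <= PI * (INR k + / 2) * cbinR k ^ 2.
Proof.
have h := wallis_decr (2 * k); have e := wallis_odd k; rewrite wallis_even in h.
have hb := cbinR_gt0 k; have hk := pos_INR k.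
have : wallis (2 * k).+1 * ((2 * INR k + 1) * cbinR k) <= PI / 2 * cbinR k * ((2 * INR k + 1) * cbinR k).
  by apply: Rmult_le_compat_r => //; nra.
rewrite e; nra.
Qed.

Lemma cbinR_sqr_le k : PI * INR k * cbinR k ^ 2 <= 1.
Proof.
case: k => [|k]; first by rewrite /=; lra.
have h := wallis_decr (2 * k).+1; have e := wallis_odd k.
rewrite -[(2 * k).+2](mulnS 2 k) wallis_even in h.
have hb := cbinR_gt0 k.+1; have hk := pos_INR k; have e2 := cbinRS k.
have : PI / 2 * cbinR k.+1 * ((2 * INR k + 1) * cbinR k) <= 1.
  rewrite -[X in _ <= X]e; apply: Rmult_le_compat_r => //.
  by have := cbinR_gt0 k; nra.
rewrite -e2 S_INR; nra.
Qed.

End Wallis.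

(** * The integer bounds as multiples of the number of trees *)

Lemma tree_count_gt0 m k : (1 <= m)%N -> (0 < tree_count m k)%N.
Proof.
move=> hm; rewrite -(@ltn_pmul2l k.+1) // tree_count_cbin muln0 muln_gt0 cbin_gt0.
by rewrite expn_gt0 hm.
Qed.

Lemma total_edges_le m K N : (1 <= m)%N -> (1 <= K <= N)%N ->
  (2 * 4 ^ K * K.+1 * total_edges m N <=
   3 * cbin K * (2 * (4 * m) ^ K + N.*2.+1 * K.+1) * tree_count m N)%N.
Proof.
move=> hm hK; have h := total_edges_upper m K N hm hK.
rewrite -(@leq_pmul2l N.+1) //.
have eK := tree_count_cbin m K; have eN := tree_count_cbin m N.
have h4 := obin_exp4 K (N - K); rewrite subnKC in h4; last by lia.
rewrite /obin -/(obin (N - K)) in h4.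
have h1 : (2 * N.+1 * total_edges m N * (4 ^ K * K.+1) <=
  6 * N.+1 * tree_count m N * 4 ^ K * (K.+1 * tree_count m K)
  + 3 * m ^ N * cbin K * K.+1 * (4 ^ K * obin (N - K)))%N.
  have := leq_mul h (leqnn (4 ^ K * K.+1)%N); lia.
have h2 := leq_mul (leqnn (3 * m ^ N * cbin K * K.+1)%N) h4.
have h3 : (3 * m ^ N * cbin K * K.+1 * (N.*2.+1 * cbin N) =
  3 * cbin K * K.+1 * N.*2.+1 * (N.+1 * tree_count m N))%N by rewrite eN; lia.
rewrite eK in h1; rewrite h3 in h2; rewrite expnMn.
set A := (3 * m ^ N * cbin K * K.+1 * (4 ^ K * obin (N - K)))%N in h1 h2.
lia.
Qed.

(** A total over all trees with [N] nodes, as is [expected_pairs]; dividing by [tree_count m N]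
    gives the expectation. *)
Definition expected_occurrences (m K N : nat) : nat :=
  (\sum_(K <= k < N.+1) root_edges m k * (m ^ (N - k) * cbin (N - k)))%N.

Definition expected_pairs (m K N : nat) : nat :=
  (\sum_(K <= k < N.+1) root_edges m k * pairs m N k)%N.

Lemma expected_occurrences_ge m K N : (K < N)%N ->
  (3 * K * (N - K.+1) * N.*2.+1 * cbin K.+1 * tree_count m N <=
   N * 4 ^ K.+1 * K.*2.+1 * expected_occurrences m K.+1 N)%N.
Proof.
move=> hK; have h := expected_edges_lower m K N hK; rewrite -/(expected_occurrences _ _ _) in h.
rewrite -(@leq_pmul2l N.+1) //.
have eN := tree_count_cbin m N.
have h4 := obin_exp4_lower K.+1 (N - K.+1); rewrite subnKC // in h4.
have h1 := leq_mul (leqnn (N * 4 ^ K.+1)%N) h.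
have h2 := leq_mul (leqnn (3 * K * m ^ N * cbin K.+1)%N) h4.
have h3 : (3 * K * m ^ N * cbin K.+1 * ((N - K.+1) * obin N) =
  3 * K * cbin K.+1 * (N - K.+1) * N.*2.+1 * (N.+1 * tree_count m N))%N by rewrite eN /obin; lia.
rewrite h3 in h2; move: (N - K.+1)%N h1 h2 {h h3 h4} => d; move: (obin d) => o.
move: (4 ^ K.+1)%N => p; lia.
Qed.

Lemma expected_pairs_le m K N : (1 <= m)%N ->
  (2 * 4 ^ K * K.+1 * (4 * m) ^ K * expected_pairs m K N <=
   cbin K * N.*2.+1 * N.+1 * tree_count m N)%N.
Proof.
move=> hm; have h := sum_pairs m N K hm; have eN := tree_count_cbin m N.
have h1 : (2 * expected_pairs m K N <= 3 * \sum_(K <= k < N.+1) tree_count m k * pairs m N k)%N.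
  rewrite /expected_pairs !big_distrr /=; apply: leq_sum => k _.
  by rewrite !mulnA leq_mul2r root_edges_le orbT.
have h2 := leq_mul (leqnn (4 ^ K * K.+1 * (4 * m) ^ K)%N) h1.
have -> : (cbin K * N.*2.+1 * N.+1 * tree_count m N = cbin K * m ^ N * obin N)%N.
  by rewrite -mulnA eN /obin; lia.
apply: leq_trans h; move: h2; lia.
Qed.

(** * Real bounds on the mean number of edges *)

Section RealBounds.
Local Open Scope R_scope.

Lemma INR_expn a b : INR (a ^ b)%N = INR a ^ b.
Proof. by elim: b => [|b IH] //; rewrite expnS mult_INR IH. Qed.

Lemma INR_double n : INR n.*2 = 2 * INR n.
Proof. by rewrite -addnn plus_INR; ring. Qed.

Lemma cbinE k : INR (cbin k) = 4 ^ k * cbinR k.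
Proof. by rewrite /cbinR; field; apply: pow_nonzero; lra. Qed.

Lemma INR4 : INR 4 = 4.
Proof. by rewrite /=; ring. Qed.

Lemma INR2 : INR 2 = 2.
Proof. by []. Qed.

Lemma INR3 : INR 3 = 3.
Proof. by rewrite /=; ring. Qed.

Definition mean_edges (m N : nat) : R := INR (total_edges m N) / INR (tree_count m N).

Lemma avg_dag_edgesE m n : avg_dag_edges m n = mean_edges m n.+1.
Proof. by rewrite /avg_dag_edges /mean_edges /total_edges sumnE big_map. Qed.

Lemma mean_edges_le m K N : (1 <= m)%N -> (1 <= K <= N)%N ->
  2 * (INR K + 1) * mean_edges m N <=
  3 * cbinR K * (2 * (4 * INR m) ^ K + (2 * INR N + 1) * (INR K + 1)).
Proof.
move=> hm hK; have T0 : 0 < INR (tree_count m N) by apply: lt_0_INR; apply/ltP; exact: tree_count_gt0.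
have /leP/le_INR := total_edges_le m K N hm hK.
rewrite !(INR4, INR2, INR3, mult_INR, plus_INR, INR_expn, S_INR, INR_double, cbinE).
have p : 0 < 4 ^ K by apply: pow_lt; lra.
have -> : INR (total_edges m N) = mean_edges m N * INR (tree_count m N).
  by rewrite /mean_edges; field; lra.
move=> h; apply: (Rmult_le_reg_r (4 ^ K * INR (tree_count m N))); first exact: Rmult_lt_0_compat.
by apply: Rle_trans (Rle_trans _ _ _ _ h) _; apply: Req_le; ring.
Qed.

(** Here [w] and [v] are the mean numbers of occurrences and of pairs, for subtrees with more than
    [K] nodes, weighted by the children of their roots. *)
Lemma mean_edges_ge m K N : (1 <= m)%N -> (K < N)%N ->
  exists w v, w <= mean_edges m N + v /\
  3 * INR K * (INR N - INR K - 1) * (2 * INR N + 1) * cbinR K.+1 <= INR N * (2 * INR K + 1) * w /\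
  2 * (INR K + 2) * (4 * INR m) ^ K.+1 * v <= cbinR K.+1 * (2 * INR N + 1) * (INR N + 1).
Proof.
move=> hm hK; have T0 : 0 < INR (tree_count m N) by apply: lt_0_INR; apply/ltP; exact: tree_count_gt0.
set T := INR (tree_count m N) in T0.
exists (INR (expected_occurrences m K.+1 N) / T), (INR (expected_pairs m K.+1 N) / T).
have p : 0 < 4 ^ K.+1 by apply: pow_lt; lra.
have hd (x : R) : x / T * T = x by field; lra.
split; last split.
- apply: (Rmult_le_reg_r T) => //; rewrite /mean_edges -/T Rmult_plus_distr_r !hd -plus_INR.
  by apply/le_INR/leP; apply: total_edges_lower; lia.
- have /leP/le_INR := expected_occurrences_ge m K N hK.
  rewrite !(mult_INR, minus_INR, INR_expn) -?/T; last by apply/leP.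
  rewrite !(INR4, INR3, S_INR, INR_double, cbinE) => h.
  apply: (Rmult_le_reg_r (4 ^ K.+1 * T)); first exact: Rmult_lt_0_compat.
  apply: Rle_trans (Rle_trans _ _ _ _ h) _; apply: Req_le; first by ring.
  rewrite -[X in _ * X = _](hd (INR _)); ring.
- have /leP/le_INR := expected_pairs_le m K.+1 N hm.
  rewrite !(mult_INR, INR_expn) -?/T.
  rewrite !(INR4, INR2, S_INR, INR_double, cbinE) => h.
  apply: (Rmult_le_reg_r (4 ^ K.+1 * T)); first exact: Rmult_lt_0_compat.
  apply: Rle_trans (Rle_trans _ _ _ _ h) _; apply: Req_le; last by ring.
  rewrite -[X in _ = _ * X](hd (INR _)); ring.
Qed.

End RealBounds.

(** * Relative errors and the asymptotic formula *)

Section Asymptotics.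
Local Open Scope R_scope.

Lemma mean_edges_relative m K n : (1 <= m)%N -> (0 < K)%N ->
  ((4 * m) ^ K <= n < (4 * m) ^ K.+1)%N ->
  Rabs (mean_edges m n.+1 / (3 * INR n * cbinR K) - 1) <= (10 * INR m + 3) / INR K.
Proof.
move=> hm; case: K => [//|K] _ /andP[hlo hhi].
(* Since [q < 2^q], [q^2 <= 4^q <= (4m)^q <= n]; this makes the loss [q / n] at most [1 / q]. *)
have hsq : (K.+1 ^ 2 <= n)%N.
  have h4 : (K.+1 ^ 2 <= 4 ^ K.+1)%N.
    by rewrite -[4%N]/(2 ^ 2)%N -expnM mulnC expnM leq_exp2r // ltnW // ltn_expl.
  apply: leq_trans hlo; apply: leq_trans h4 _; rewrite leq_exp2r //; lia.
have hKn : (K.+1 <= n)%N by apply: leq_trans hsq; rewrite expnS expn1 leq_pmulr.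
have U := mean_edges_le m K.+1 n.+1 hm (leqW hKn : (1 <= K.+1 <= n.+1)%N).
have [w [v [WV [W V]]]] := mean_edges_ge m K n.+1 hm (leqW hKn : (K < n.+1)%N).
have /leP/le_INR := hm; rewrite [INR 1]/= => HM.
have /leP/le_INR := hlo; rewrite INR_expn mult_INR INR4 => Hlo.
have /ltnW/leP/le_INR := hhi; rewrite INR_expn mult_INR INR4 => Hhi.
have /leP/le_INR := hsq; rewrite INR_expn => Hsq.
have b0 := cbinR_gt0 K.+1.
rewrite -tech_pow_Rmult in Hhi.
have p0 : 0 < (4 * INR m) ^ K.+1 by apply: pow_lt; lra.
have k0 := pos_INR K.
(* From here on [q] is the threshold, [p = (4m)^q], [r = n], [b = cbinR q], and [x], [y], [z] are
   the mean, [w] and [v] divided by [3 r b]. *)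
move: U WV W V Hlo Hhi Hsq p0 b0; rewrite !S_INR.
move: (cbinR _) ((4 * INR m) ^ K.+1) => b p.
move: (INR m) (INR n) (mean_edges _ _) HM k0 => M r E HM.
have -> : INR K = INR K + 1 - 1 by ring.
move: (INR K + 1) => q k0; rewrite (_ : q - 1 + 1 = q); last by ring.
move=> U WV W V Hlo Hhi Hsq p0 b0.
have q1 : 1 <= q by lra.
have qr : q <= r by rewrite /= in Hsq; nra.
have rb0 : 0 < 3 * r * b by nra.
have hd (t : R) : t = 3 * r * b * (t / (3 * r * b)) by field; nra.
rewrite (hd E) in U WV; rewrite (hd v) in V WV; rewrite (hd w) in W WV.
move: (E / _) (v / _) (w / _) U WV W V => x z y U WV W V.
have {}WV : y <= x + z by apply: (Rmult_le_reg_l (3 * r * b)) => //; lra.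
have {}U : 2 * (q + 1) * r * x <= 2 * p + (2 * r + 3) * (q + 1).
  by apply: (Rmult_le_reg_l (3 * b)); lra.
have {}W : (q - 1) * (r + 1 - q) * (2 * r + 3) <= (r + 1) * (2 * q - 1) * r * y.
  by apply: (Rmult_le_reg_l (3 * b)); lra.
have {}V : 6 * (q + 1) * p * r * z <= (2 * r + 3) * (r + 2).
  by apply: (Rmult_le_reg_l b); lra.
have hx : q * x <= q + 3.
  apply: (Rmult_le_reg_l (2 * (q + 1) * r)); first nra.
  have := Rmult_le_compat_l q _ _ ltac:(lra) U; nra.
have hy : q - 2 <= q * y.
  apply: (Rmult_le_reg_l ((r + 1) * (2 * q - 1) * r)); first by apply: Rmult_lt_0_compat; nra.
  have h1 := Rmult_le_compat_l q _ _ ltac:(lra) W.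
  have h2 : (r + 1) * (2 * q - 1) * (q - 2) <= 2 * q * (q - 1) * (r + 1 - q) by nra.
  have h3 := Rmult_le_compat_l r _ _ ltac:(lra) h2.
  have h4 : 0 <= q * ((q - 1) * (r + 1 - q)) by apply: Rmult_le_pos; nra.
  nra.
(* By [V], [6 (q + 1) p z <= 15 r], and [r <= 4 M p], whence [60 / 6 = 10]. *)
have hz : q * z <= 10 * M.
  case: (Rle_dec z 0) => [z0|/Rnot_le_lt z0]; first by nra.
  have h1 : (2 * r + 3) * (r + 2) <= 15 * r * r by nra.
  have h2 : 6 * (q + 1) * p * z <= 60 * (M * p).
    by apply: (Rmult_le_reg_l r); nra.
  have h3 : (q + 1) * z <= 10 * M by apply: (Rmult_le_reg_l (6 * p)); lra.
  nra.
have -> : x - 1 = (q * x - q) / q by field; lra.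
have iq : 0 <= / q by apply/Rlt_le/Rinv_0_lt_compat; lra.
rewrite /Rdiv; apply: Rabs_le; rewrite Ropp_mult_distr_l.
have hq : q * y <= q * (x + z) by apply: Rmult_le_compat_l; lra.
by split; apply: Rmult_le_compat_r => //; lra.
Qed.

Lemma Rabs_sub1_le_sqr x : 0 <= x -> Rabs (x - 1) <= Rabs (x ^ 2 - 1).
Proof.
move=> x0; have -> : x ^ 2 - 1 = (x - 1) * (x + 1) by ring.
rewrite Rabs_mult (Rabs_pos_eq (x + 1)); last by lra.
have := Rabs_pos (x - 1); nra.
Qed.

(** The square of the ratio is [PI cbinR(K)^2] times [x / L]. The first factor lies in
    [[1/(K + 1/2), 1/K]] by Wallis, the second in [[K, K + 1]]. *)
Lemma cbinR_main_term L K x : 0 < L -> (0 < K)%N -> INR K * L <= x <= (INR K + 1) * L ->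
  Rabs (cbinR K * sqrt x / sqrt (L / PI) - 1) <= / INR K.
Proof.
move=> L0 hK [hlo hhi]; have hpi := PI_RGT_0.
have /leP/le_INR := hK; rewrite [INR 1]/= => k1.
have x0 : 0 < x by nra.
have b0 := cbinR_gt0 K; have LP : 0 < L / PI by apply: Rdiv_lt_0_compat.
have sx := sqrt_lt_R0 _ x0; have sL := sqrt_lt_R0 _ LP.
apply: Rle_trans (Rabs_sub1_le_sqr _ _) _.
  by apply/Rlt_le/Rdiv_lt_0_compat => //; nra.
have -> : (cbinR K * sqrt x / sqrt (L / PI)) ^ 2 = PI * cbinR K ^ 2 * (x / L).
  have e1 := sqrt_sqrt x (Rlt_le _ _ x0); have e2 := sqrt_sqrt _ (Rlt_le _ _ LP).
  transitivity (cbinR K ^ 2 * (sqrt x * sqrt x) / (sqrt (L / PI) * sqrt (L / PI))).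
    by field; lra.
  by rewrite e1 e2; field; lra.
have h1 := cbinR_sqr_ge K; have h2 := cbinR_sqr_le K.
have eL : x / L * L = x by field; lra.
have hl : INR K <= x / L by apply: (Rmult_le_reg_r L) => //; rewrite eL.
have hu : x / L <= INR K + 1 by apply: (Rmult_le_reg_r L) => //; rewrite eL.
set y := x / L in hl hu *; set c := PI * cbinR K ^ 2.
have c0 : 0 < c by apply: Rmult_lt_0_compat => //; apply: pow_lt.
have {}h1 : 1 <= (INR K + / 2) * c by rewrite /c; lra.
have {}h2 : INR K * c <= 1 by rewrite /c; lra.
set k := INR K in k1 hl hu h1 h2 *.
have e : / k * k = 1 by field; lra.
have ik : 0 < / k by apply: Rinv_0_lt_compat; lra.
apply: Rabs_le; split.
  apply: (Rmult_le_reg_r k); first lra.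
  nra.
apply: (Rmult_le_reg_r k); first lra.
nra.
Qed.

End Asymptotics.

(* E_{m,n} = 3 kappa_m n / sqrt(ln n) * (1 + O(1/ln n)) as n -> oo, i.e.
   the relative error | E / main - 1 | is eventually bounded by C / ln n. *)
Theorem theorem8 (m : nat) (hm : (1 <= m)%N) :
  exists (C : R) (N : nat),
    forall n : nat, (N <= n)%N ->
      (Rabs (avg_dag_edges m n
             / (3 * kappa m * INR n / sqrt (ln (INR n))) - 1)
       <= C / ln (INR n))%R.
Proof.
pose L := ln (4 * INR m); pose A := (10 * INR m + 3)%R.
(* The error is at most [(2A + 1) / K], and [ln n <= (K + 1) L <= 2 K L] turns [1 / K] into
   [2 L / ln n]. The condition [n >= 4m] ensures [K >= 1]. *)
exists ((2 * A + 1) * (2 * L))%R, (4 * m)%N => n hn.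
have hm4 : (1 < 4 * m)%N by lia.
have n0 : (0 < n)%N by lia.
have /andP[hlo hhi] := trunc_log_bounds hm4 n0.
set K := trunc_log _ _ in hlo hhi.
have K0 : (0 < K)%N.
  by case: K hlo hhi => [|K] // _; rewrite expn1; lia.
have hx := mean_edges_relative m K n hm K0 (introT andP (conj hlo hhi)).
have /leP/le_INR := hm; rewrite [INR 1]/= => HM.
have /leP/le_INR := K0; rewrite [INR 1]/= => HK.
have L0 : (0 < L)%R by rewrite -ln_1; apply: ln_increasing; lra.
have p0 k : (0 < (4 * INR m) ^ k)%R by apply: pow_lt; lra.
have Hlo : (INR K * L <= ln (INR n))%R.
  rewrite -ln_pow; last lra.
  have /leP/le_INR := hlo; rewrite INR_expn mult_INR INR4 => h.
  exact: ln_le (p0 K) h.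
have Hhi : (ln (INR n) <= (INR K + 1) * L)%R.
  rewrite -S_INR -ln_pow; last lra.
  have /ltnW/leP/le_INR := hhi; rewrite INR_expn mult_INR INR4 => h.
  apply: ln_le h; apply: lt_0_INR; exact/ltP.
have hr := cbinR_main_term L K _ L0 K0 (conj Hlo Hhi).
have b0 := cbinR_gt0 K; have hpi := PI_RGT_0.
have ln0 : (0 < ln (INR n))%R by nra.
have r0 : (0 < INR n)%R by apply: lt_0_INR; apply/ltP.
have sn := sqrt_lt_R0 _ ln0.
have sk : (0 < sqrt (L / PI))%R by apply/sqrt_lt_R0/Rdiv_lt_0_compat.
rewrite avg_dag_edgesE /kappa -/L.
set E := mean_edges _ _ in hx *.
set x := (E / (3 * INR n * cbinR K))%R in hx.
set rho := (cbinR K * sqrt (ln (INR n)) / sqrt (L / PI))%R in hr.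
(* The ratio is [x rho]: [x] compares the mean with [3 n cbinR K], and [rho] compares [cbinR K] with
   [kappa m / sqrt (ln n)]. *)
have -> : (E / (3 * sqrt (L / PI) * INR n / sqrt (ln (INR n))) - 1 = (x - 1) * rho + (rho - 1))%R.
  by rewrite /x /rho; field; lra.
have iK : (0 < / INR K <= 1)%R.
  split; first by apply: Rinv_0_lt_compat; lra.
  by rewrite -Rinv_1; apply: Rinv_le_contravar; lra.
have hrho : (Rabs rho <= 2)%R.
  have := Rabs_triang (rho - 1) 1; rewrite Rabs_R1; have -> : (rho - 1 + 1 = rho)%R by ring.
  lra.
apply: Rle_trans (Rabs_triang _ _) _; rewrite Rabs_mult.
have h1 : (Rabs (x - 1) * Rabs rho <= A / INR K * 2)%R.
  by apply: Rmult_le_compat => //; exact: Rabs_pos.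
apply: (Rle_trans _ ((2 * A + 1) * / INR K)%R).
  have -> : ((2 * A + 1) * / INR K = A / INR K * 2 + / INR K)%R by rewrite /Rdiv; ring.
  lra.
rewrite /Rdiv Rmult_assoc; apply: Rmult_le_compat_l; first by rewrite /A; lra.
apply: (Rmult_le_reg_r (INR K * ln (INR n))%R); first nra.
have -> : (/ INR K * (INR K * ln (INR n)) = ln (INR n))%R by field; lra.
have -> : (2 * L * / ln (INR n) * (INR K * ln (INR n)) = 2 * L * INR K)%R by field; lra.
nra.
Qed.
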